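(* Let $A=\{a_1,a_2,\ldots,a_k\}$ be a set of positive integers with $a_1<a_2<\cdots<a_k$, and let $\ell$ be a positive integer. Then there exists an $\ell$-Sperner family $\mathcal{S}$ (of subsets of $[n]$, for some $n$) with $A\in\operatorname{osh}(\mathcal{S})$ if and only if $$\sum_{i=1}^k\frac1{2^{a_i-i}}<\ell.$$
   Context: $[n]=\{1,\ldots,n\}$; $[a,b]=\{a,a+1,\ldots,b\}$, which is empty if $a>b$; $\mathcal{P}(A)$ is the set of all subsets of $A$. Order shattering. Let $S\subseteq[n]$ and $\mathcal{F}\subseteq\mathcal{P}([n])$. Inductively: $S=\varnothing$ is order shattered by $\mathcal{F}$ iff $\mathcal{F}\neq\varnothing$. If $S=\{s_1<s_2<\cdots<s_k\}$ with $k\ge1$, then $S$ is order shattered by $\mathcal{F}$ iff there exist disjoint families $\widetilde{\mathcal{F}_0},\widetilde{\mathcal{F}_1}\subseteq\mathcal{F}$, each of size $2^{k-1}$, such that, with $T=[s_k+1,n]$ (possibly empty): (a) $T\cap C=T\cap D$ for all $C\in\widetilde{\mathcal{F}_0}$ and $D\in\widetilde{\mathcal{F}_1}$; (b) $s_k\notin C$ and $s_k\in D$ for all $C\in\widetilde{\mathcal{F}_0}$ and $D\in\widetilde{\mathcal{F}_1}$; (c) each of $\widetilde{\mathcal{F}_0}$ and $\widetilde{\mathcal{F}_1}$ individually order shatters $S\setminus\{s_k\}$. Then $\operatorname{osh}(\mathcal{F})=\{S\subseteq[n]:\mathcal{F}\text{ order shatters }S\}$. For a positive integer $\ell$, a family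 $\mathcal{S}\subseteq\mathcal{P}([n])$ is an $\ell$-Sperner family if there do not exist distinct $S_1,\ldots,S_{\ell+1}\in\mathcal{S}$ with $S_1\subset S_2\subset\cdots\subset S_{\ell+1}$. *)

(* Defs.v *)
From mathcomp Require Import all_boot all_order all_algebra finmap.

Set Implicit Arguments.
Unset Strict Implicit.
Unset Printing Implicit Defensive.

Local Open Scope fset_scope.

(* Sets of positive integers are finite sets of naturals, so that a set and a
   family do not carry the size n of the ground set [n] in their types. *)

Definition interval (a b : nat) : {fset nat} :=
  [fset i in index_iota a b.+1].

Definition ground (n : nat) : {fset nat} := interval 1 n.

(* order_shatters n S F : the family F, whose members are subsets of [n],
   order shatters S.  In the second constructor s is the maximum of S, and
   #|` S `\ s| is |S| - 1. *)
Inductive order_shatters (n : nat) :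
    {fset nat} -> {fset {fset nat}} -> Prop :=
| order_shatters0 (F : {fset {fset nat}}) :
    F != fset0 -> order_shatters n fset0 F
| order_shattersS (S : {fset nat}) (F : {fset {fset nat}}) (s : nat)
    (F0 F1 : {fset {fset nat}}) :
    s \in S -> (forall t, t \in S -> t <= s) ->
    F0 `<=` F -> F1 `<=` F -> [disjoint F0 & F1] ->
    #|` F0| = 2 ^ #|` S `\ s| -> #|` F1| = 2 ^ #|` S `\ s| ->
    (forall C D : {fset nat}, C \in F0 -> D \in F1 ->
       interval s.+1 n `&` C = interval s.+1 n `&` D) ->
    (forall C D : {fset nat}, C \in F0 -> D \in F1 -> s \notin C /\ s \in D) ->
    order_shatters n (S `\ s) F0 -> order_shatters n (S `\ s) F1 ->
    order_shatters n S F.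

Definition osh (n : nat) (F : {fset {fset nat}}) (S : {fset nat}) : Prop :=
  S `<=` ground n /\ order_shatters n S F.

Definition sperner (l : nat) (F : {fset {fset nat}}) : Prop :=
  ~ exists c : l.+1.-tuple {fset nat},
      [/\ {subset c <= F}, uniq c & sorted fsubset c].

(* Main.v *)
Require Import Defs.
From mathcomp Require Import all_boot all_order all_algebra finmap.
From mathcomp Require Import zify.

(** Unfolding the recursive definition of order shattering from the top down
    turns it into a game.  The membership of n, n-1, ..., 1 in a set C is
    decided one element at a time; at an element of S an opponent decides, at
    any other element, a gap, the player decides, and the player wins if
    C \in F.  Then F order shatters S exactly when the player has a winning
    strategy (lemmas [order_shatters_game] and [game_order_shatters]).

    A position of the game is a pair of b and a set U of elements above b: the
    decisions about n, ..., b+1.  The question is how long a chain of sets the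
    player can be forced to admit.  Suppose that at level b + 1 there is a chain
    U_1 < ... < U_m of winning positions.
    - If b+1 is in S, then U_1 and the U_i with b+1 added all win at level b:
      the chain has length m + 1.
    - If b+1 is a gap, then each U_i or U_i with b+1 added wins, and one of the
      two answers occurs for at least half of the i: the chain has length at
      least m / 2, rounded up.
    The second bound is sharp.  If all positions carry a rank in [0, h) that
    increases strictly with inclusion, the player puts b+1 into those of small
    rank and leaves it out of those of large rank.  No position of the first
    kind is then contained in one of the second, so both halves can reuse the
    ranks below h / 2, rounded up.  An element of S raises the
    number of ranks by one only.

    So the length of the chain that can be forced, starting from 1, obeys
    m -> m + 1 at elements of S and m -> ceil (m / 2) at gaps.  With
    Z = 2 ^ gaps S n and with W = weight S n, which obeys W -> W + 1 at
    elements of S and W -> 2 W at gaps (read upwards from 1 to n), an l-Sperner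
    family with a winning strategy exists if and only if W + 1 <= l Z.  This is
    the content of [game_chain] and [rank_game]; no rounding is left since the
    inequality is between integers.  Finally W / Z is the sum over a in S of
    1 / 2 ^ gaps S a, and the i-th element a_i of S has exactly a_i - i gaps
    below it ([weight_sum], [gaps_enum]). *)

Set Implicit Arguments.
Unset Strict Implicit.
Unset Printing Implicit Defensive.

Import Order.TTheory GRing.Theory Num.Theory.
Local Open Scope fset_scope.
Local Open Scope ring_scope.

Implicit Types (S C U V : {fset nat}) (F : {fset {fset nat}}) (b n l : nat).

(** * Order shattering as a game *)

Fixpoint game S F b U : bool :=
  if b is b'.+1 then
    if b \in S then game S F b' U && game S F b' (b |` U)
    else game S F b' U || game S F b' (b |` U)
  else U \in F.

Definition above b C : {fset nat} := [fset x in C | (b < x)%N].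

Definition gaps S b : nat := count [pred x | x \notin S] (iota 1 b).

(** Equals the sum of 2 ^ (gaps S b - gaps S x) over the x in S with
    0 < x <= b; the
    recursion is the form that the inductions on b use. *)
Fixpoint weight S b : nat :=
  if b is b'.+1 then
    if b \in S then (weight S b').+1 else (weight S b').*2
  else 0%N.

Lemma in_interval i j x : (x \in Defs.interval i j) = (i <= x <= j)%N.
Proof. by rewrite !inE /= mem_index_iota ltnS. Qed.

Lemma in_above b C x : (x \in above b C) = (x \in C) && (b < x)%N.
Proof. by rewrite !inE. Qed.

Lemma aboveS b C :
  above b C = if b.+1 \in C then b.+1 |` above b.+1 C else above b.+1 C.
Proof.
apply/fsetP => x; case: ifP => bC; rewrite ?in_fset1U !in_above.
  by case: (eqVneq x b.+1) => [->|]; rewrite ?bC //; case: (x \in C) => //=; lia.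
by case: (eqVneq x b.+1) => [->|]; rewrite ?bC //; case: (x \in C) => //=; lia.
Qed.

Lemma above0 C : 0%N \notin C -> above 0 C = C.
Proof.
move=> C0; apply/fsetP => x; rewrite in_above; case: x => [|x].
  by rewrite (negPf C0).
by rewrite andbT.
Qed.

Lemma above_ground n C : C `<=` ground n -> above n C = fset0.
Proof.
move=> /fsubsetP Cn; apply/fsetP => x; rewrite in_above in_fset0.
by case xC: (x \in C) => //=; move: (Cn x xC); rewrite in_interval; lia.
Qed.

Lemma game_sub S S' F F' b U :
    (forall x, (x <= b)%N -> (x \in S) = (x \in S')) -> F `<=` F' ->
  game S F b U -> game S' F' b U.
Proof.
move=> + /fsubsetP sF; elim: b U => [|b IH] U SS' /=; first exact: sF.
have {}IH V := IH V (fun x xb => SS' x (leqW xb)).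
rewrite SS' //; case: ifP => _; first by case/andP=> /IH-> /IH->.
by case/orP=> /IH->; rewrite ?orbT.
Qed.

Lemma game_above S F C s b :
    (s <= b)%N -> (forall x, x \in S -> (x <= b)%N -> (x <= s)%N) ->
  game S F s (above s C) -> game S F b (above b C).
Proof.
elim: b => [|b IH]; first by rewrite leqn0 => /eqP->.
rewrite leq_eqVlt => /predU1P[-> //|]; rewrite ltnS => sb Ss gs /=.
have /IH : forall x, x \in S -> (x <= b)%N -> (x <= s)%N.
  by move=> x xS xb; apply: Ss => //; lia.
case: ifP => [bS|_]; first by move: (Ss _ bS (leqnn _)); lia.
by move=> /(_ sb gs); rewrite aboveS; case: ifP => _ ->; rewrite ?orbT.
Qed.

(** The two subfamilies attached to s = max S are won by induction from level
    s - 1.  Condition (a) says that the plays that win in them coincide above s,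
    so they join into one winning position at level s; the elements above s are
    gaps, where the player follows either play. *)
Lemma order_shatters_game n S F :
    order_shatters n S F -> (forall C, C \in F -> C `<=` ground n) ->
  forall b, (forall t, t \in S -> (0 < t <= b)%N) ->
  exists2 C, C \in F & game S F b (above b C).
Proof.
elim=> {S F} [F F0 | S F s F0 F1 sS smax sF0 sF1 _ _ _ agree sC _ IH0 _ IH1].
  move=> Fn b _; case/fset0Pn: F0 => C CF; exists C => //.
  apply: (@game_above _ _ _ 0%N) => //=; rewrite above0 //; apply/negP => C0.
  by move/fsubsetP/(_ _ C0): (Fn C CF); rewrite in_interval.
move=> Fn b Sb; have s0 := Sb s sS.
have Fn0 C : C \in F0 -> C `<=` ground n by move/(fsubsetP sF0)/Fn.
have Fn1 C : C \in F1 -> C `<=` ground n by move/(fsubsetP sF1)/Fn.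
have Ss t : t \in S `\ s -> (0 < t <= s.-1)%N.
  rewrite in_fsetD1 => /andP[ts tS]; move: (Sb t tS) (smax t tS); lia.
have [C CF0 gC] := IH0 Fn0 _ Ss; have [D DF1 gD] := IH1 Fn1 _ Ss.
exists C; first exact: (fsubsetP sF0).
have [sC' sD] := sC C D CF0 DF1.
have CD : above s C = above s D.
  apply/fsetP => x; rewrite !in_above; move/fsetP/(_ x): (agree C D CF0 DF1).
  rewrite !in_fsetI !in_interval; case: (ltnP s x); rewrite ?andbT ?andbF //= => _.
  (* Above n the two sets agree because both are empty there. *)
  case: (leqP x n) => //= nx _.
  have out E : E `<=` ground n -> (x \in E) = false.
    move=> /fsubsetP En; apply/negP => /En; rewrite in_interval.
    by rewrite [(x <= n)%N]leqNgt nx andbF.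
  by rewrite (out C) ?(out D) ?(Fn0 C) ?(Fn1 D).
apply: (@game_above _ _ _ s) => //; [by case/andP: s0 | by move=> x /smax |].
move: s0 sS sC' sD CD gC gD; clear -sF0 sF1.
case: s => [|s] // _ sS sC' sD CD; rewrite [s.+1.-1]/=.
rewrite (aboveS s C) (aboveS s D) (negPf sC') sD CD.
move=> gC gD; rewrite /= sS.
have SS' x : (x <= s)%N -> (x \in S `\ s.+1) = (x \in S).
  by rewrite in_fsetD1 => xs; have -> : x != s.+1 by lia.
by rewrite (game_sub SS' sF0 gC) (game_sub SS' sF1 gD).
Qed.

(** Collecting the results of all plays against a fixed winning strategy gives a
    binary tree of 2 ^ |S| sets.  That all of them restrict to U above b is the
    induction hypothesis that yields condition (a). *)
Lemma game_order_shatters n S F b U :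
    game S F b U -> (forall t, t \in S -> (0 < t <= b)%N) ->
    (forall x, x \in U -> (b < x)%N) ->
  exists F' : {fset {fset nat}}, [/\ F' `<=` F, #|` F'| = (2 ^ #|` S|)%N,
    forall C, C \in F' -> above b C = U & order_shatters n S F'].
Proof.
elim: b S U => [|b IH] S U /=.
  move=> UF S0 U0; have -> : S = fset0.
    by apply/eqP/fset0Pn => -[t /S0]; lia.
  exists [fset U]; split; rewrite ?fsub1set ?cardfs1 ?cardfs0 //.
    move=> C /fset1P->; apply: above0; apply/negP => /U0; lia.
  by constructor; apply/fset0Pn; exists U; rewrite fset11.
move=> + Sb Ub; set V := b.+1 |` U.
have Ub' x : x \in U -> (b < x)%N by move/Ub; lia.
have Vb' x : x \in V -> (b < x)%N by case/fset1UP=> [->|/Ub'].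
have bU : b.+1 \notin U by apply/negP => /Ub; lia.
have aboveU C : above b C = U -> above b.+1 C = U /\ b.+1 \notin C.
  rewrite aboveS; case: ifPn => // bC eU.
  by move: bU; rewrite -eU fset1U1.
have aboveV C : above b C = V -> above b.+1 C = U /\ b.+1 \in C.
  rewrite aboveS /V; case: ifPn => bC eV; last first.
    have: b.+1 \in above b.+1 C by rewrite eV fset1U1.
    by rewrite in_above ltnn andbF.
  split=> //; apply/fsetP => x; move/fsetP/(_ x): eV.
  rewrite !in_fset1U; case: (eqVneq x b.+1) => //= -> _.
  by rewrite (negPf bU) in_above ltnn andbF.
case: ifPn => bS; last first.
  have {}Sb t : t \in S -> (0 < t <= b)%N.
    move=> tS; have: t != b.+1 by apply: contraNneq bS => <-.
    by move: (Sb t tS); lia.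
  by case/orP=> g; have [F' [? ? h ?]] := IH _ _ g Sb ltac:(done);
    exists F'; split=> // C /h; [case/aboveU | case/aboveV].
have SS' x : (x <= b)%N -> (x \in S) = (x \in S `\ b.+1).
  by rewrite in_fsetD1 => xs; have -> : x != b.+1 by lia.
have {}Sb' t : t \in S `\ b.+1 -> (0 < t <= b)%N.
  by rewrite in_fsetD1 => /andP[tb /Sb]; lia.
case/andP=> /(game_sub SS' (fsubset_refl _)) g0.
move=> /(game_sub SS' (fsubset_refl _)) g1.
have [F0 [sF0 c0 h0 o0]] := IH _ _ g0 Sb' Ub'.
have [F1 [sF1 c1 h1 o1]] := IH _ _ g1 Sb' Vb'.
have dis : [disjoint F0 & F1].
  apply/fdisjointP => C CF0; apply/negP => /h1/aboveV[_].
  by have [_ /negP] := aboveU _ (h0 _ CF0).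
exists (F0 `|` F1); split.
- by rewrite fsubUset sF0.
- move: dis; rewrite -fsetI_eq0 => /eqP dis.
  by rewrite cardfsU dis cardfs0 subn0 c0 c1 addnn -mul2n -expnS
             [in RHS](cardfsD1 b.+1) bS.
- by move=> C /fsetUP[/h0/aboveU|/h1/aboveV] [].
- apply: (@order_shattersS _ _ _ b.+1 F0 F1) => //.
  + by move=> t /Sb; lia.
  + exact: fsubsetUl.
  + exact: fsubsetUr.
  + move=> C D /h0/aboveU[eC _] /h1/aboveV[eD _].
    apply/fsetP => x; rewrite !in_fsetI !in_interval.
    case: (ltnP b.+1 x) => //= bx; congr (_ && _).
    by move/fsetP/(_ x): eC; move/fsetP/(_ x): eD; rewrite !in_above bx !andbT => -> ->.
  + by move=> C D /h0/aboveU[_ ?] /h1/aboveV[_ ?].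
Qed.

Lemma order_shatters_sub n S F F' :
  F `<=` F' -> order_shatters n S F -> order_shatters n S F'.
Proof.
move=> FF' o; case: o FF' => {S F}.
  move=> F /fset0Pn[C CF] /fsubsetP FF'; constructor.
  by apply/fset0Pn; exists C; apply: FF'.
move=> S F s F0 F1 sS smax sF0 sF1 dis c0 c1 agree sC o0 o1 FF'.
by apply: (order_shattersS (F0 := F0) (F1 := F1) sS smax) => //;
  apply: fsubset_trans FF'.
Qed.

(** * Every strategy admits a long chain *)

Lemma gapsS S b : gaps S b.+1 = (gaps S b + (b.+1 \notin S))%N.
Proof. by rewrite /gaps -(addn1 b) iotaD count_cat /= addn0 add1n addn1. Qed.

Lemma expn_gapsS S b :
  (2 ^ gaps S b.+1 = if b.+1 \in S then 2 ^ gaps S b else (2 ^ gaps S b).*2)%N.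
Proof. by rewrite gapsS; case: ifP => _; rewrite ?addn0 // addn1 expnS mul2n. Qed.

Lemma fproper_trans : transitive (@fproper nat).
Proof. by move=> V U C UV /fproper_sub; apply: fproper_sub_trans. Qed.

Lemma fproperU1 x U V : x \notin V -> U `<` V -> x |` U `<` x |` V.
Proof.
move=> xV; rewrite !fproperEneq => /andP[neUV sUV]; rewrite fsetUS // andbT.
have xU : x \notin U by apply: contra xV => /(fsubsetP sUV).
by apply: contraNneq neUV => /(congr1 (fun C => C `\ x)); rewrite !fsetU1K // => ->.
Qed.

Lemma sorted_fproperU1 x (us : seq {fset nat}) :
    (forall U, U \in us -> x \notin U) -> sorted fproper us ->
  sorted fproper [seq x |` U | U <- us].
Proof.
move=> xus; rewrite sorted_map; apply: (sub_in_sorted (P := mem us)).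
  by move=> U V _ /xus xV; apply: fproperU1.
by apply/allP.
Qed.

(** Going down from level b, a chain of winning positions grows by one at each
    element of S and keeps at least half of its length at each gap.  The bound is
    multiplied by 2 ^ gaps S b so that it absorbs the rounding. *)
Lemma game_chain S F b (us : seq {fset nat}) :
    (0 < size us)%N -> sorted fproper us -> all (game S F b) us ->
    (forall U, U \in us -> forall x, x \in U -> (b < x)%N) ->
  exists cs : seq {fset nat}, [/\ sorted fproper cs, {subset cs <= F} &
    (size us + weight S b <= size cs * 2 ^ gaps S b)%N].
Proof.
elim: b us => [|b IH] us us0 sus.
  move=> /allP gus _; exists us; split=> //.
  by rewrite addn0 muln1.
rewrite expn_gapsS /=; case: ifP => bS gus above_us.
(* The new chain: the least position without b+1, then all with b+1. *)
- case: us => [|U us] // in us0 sus gus above_us *.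
  have nb : forall V, V \in U :: us -> b.+1 \notin V.
    by move=> V /above_us h; apply/negP => /h; lia.
  have [] := IH (U :: [seq b.+1 |` V | V <- U :: us]) => //.
  + have /= -> := sorted_fproperU1 nb sus.
    by rewrite andbT; apply: fproperUr; rewrite fsub1set nb ?mem_head.
  + apply/allP => V; rewrite inE => /predU1P[->|/mapP[W /(allP gus)]].
      by case/andP: (allP gus U (mem_head _ _)).
    by case/andP=> _ gW ->.
  + move=> V; rewrite inE => /predU1P[-> x /(above_us U (mem_head _ _))|].
      by lia.
    case/mapP=> W Wus -> x /fset1UP[->//|/(above_us W Wus)]; lia.
  move=> cs [scs csF le]; exists cs; split=> //.
  by move: le; rewrite /= size_map /=; lia.
(* Split by the winning answer at the gap b+1 and keep the larger part. *)
- set us1 := filter (game S F b) us.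
  set us2 := filter (predC (game S F b)) us.
  have szs : (size us1 + size us2 = size us)%N.
    by rewrite !size_filter count_predC.
  have [vs [vs0 svs gvs above_vs le]] : exists vs : seq {fset nat},
      [/\ (0 < size vs)%N, sorted fproper vs, all (game S F b) vs,
          (forall U, U \in vs -> forall x, x \in U -> (b < x)%N) &
          (size us <= (size vs).*2)%N].
    case: (leqP (size us2) (size us1)) => le12.
    + exists us1; split.
      * by lia.
      * by apply: sorted_filter => //; apply: fproper_trans.
      * exact: filter_all.
      * by move=> U; rewrite mem_filter => /andP[_ /above_us h] x /h; lia.
      * lia.
    + exists [seq b.+1 |` U | U <- us2]; split.
      * by rewrite size_map; lia.
      * apply: sorted_fproperU1; last first.
          by apply: sorted_filter => //; apply: fproper_trans.
        by move=> U; rewrite mem_filter => /andP[_ /above_us h]; apply/negP => /h; lia.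
      * apply/allP => V /mapP[U]; rewrite mem_filter => /andP[/= gU /(allP gus)].
        by rewrite /= (negPf gU) => gV ->.
      * move=> V /mapP[U]; rewrite mem_filter => /andP[_ /above_us h] -> x.
        by case/fset1UP => [->|/h] //; lia.
      * rewrite size_map; lia.
  have [cs [scs csF lec]] := IH vs vs0 svs gvs above_vs.
  by exists cs; split=> //; lia.
Qed.

Lemma sperner_game S F n l :
  sperner l F -> game S F n fset0 -> (weight S n < l * 2 ^ gaps S n)%N.
Proof.
move=> spF g.
have [] := @game_chain S F n [:: fset0] => //=.
- by rewrite g.
- by move=> U; rewrite inE => /eqP-> x.
move=> cs [scs csF le]; rewrite add1n in le; apply: leq_trans le _.
rewrite leq_mul2r; apply/orP; right; rewrite leqNgt; apply/negP => lcs.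
apply: spF.
have szt : size (take l.+1 cs) == l.+1 by rewrite size_takel.
have st : sorted fproper (take l.+1 cs) by apply: take_sorted.
exists (Tuple szt); split=> /=.
- by move=> C /mem_take/csF.
- apply: (sorted_uniq (leT := fproper)) st => [|C]; last exact/negbTE/fproper_irrefl.
  exact: fproper_trans.
- by apply: sub_sorted st => C D; apply: fproper_sub.
Qed.

(** * A family without longer chains *)

Lemma rank_sperner F l (r : {fset nat} -> nat) :
    (forall C, C \in F -> (r C < l)%N) ->
    (forall C D, C \in F -> D \in F -> C `<` D -> (r C < r D)%N) ->
  sperner l F.
Proof.
move=> rl rmono [c [cF uc sc]].
have {uc} sc : sorted fproper c.
  have := pairwise_relI (fun x y => x != y) fsubset c.
  move: sc; rewrite sorted_pairwise; last exact: fsubset_trans.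
  move=> ->; rewrite -uniq_pairwise uc => pc; apply: pairwise_sorted.
  by apply: sub_pairwise pc => C D /=; rewrite fproperEneq.
have : sorted ltn (map r c).
  rewrite sorted_map; apply: (sub_in_sorted (P := mem F)) sc.
    by move=> C D; apply: rmono.
  by apply/allP.
move/(sorted_uniq ltn_trans ltnn) => urc.
have /(uniq_leq_size urc) : {subset map r c <= iota 0 l}.
  by move=> x /mapP[C /cF/rl Cl ->]; rewrite mem_iota.
by rewrite size_map size_tuple size_iota ltnn.
Qed.

Lemma fproper_fsetD1 x C D : C `<` D ->
  C `\ x `<` D `\ x \/ [/\ C `\ x = D `\ x, x \notin C & x \in D].
Proof.
rewrite !fproperEneq => /andP[neCD /fsubsetP sCD].
have -> : C `\ x `<=` D `\ x.
  by apply/fsubsetP => y; rewrite !in_fsetD1 => /andP[-> /sCD].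
case: eqVneq => [eqD|]; [right | by left].
have eqCD y : y != x -> (y \in C) = (y \in D).
  by move=> yx; move/fsetP/(_ y): eqD; rewrite !in_fsetD1 yx.
have neqx : (x \in C) != (x \in D).
  apply: contraNneq neCD => eqx; apply/eqP/fsetP => y.
  by case: (eqVneq y x) => [->|/eqCD].
by move: neqx (sCD x); case: (x \in C); case: (x \in D) => // _ /(_ isT).
Qed.

(** The player's strategy, maintained for all positions at once: Us is the set of
    positions that occur at level b, and the rank r certifies that its chains
    have at most h members.  The family F is the set of positions left at level
    0. *)
Lemma rank_game S n l b (Us : {fset {fset nat}}) (r : {fset nat} -> nat) h :
    (b <= n)%N -> (h + weight S b <= l * 2 ^ gaps S b)%N ->
    (forall U, U \in Us -> U `<=` Defs.interval b.+1 n) ->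
    (forall U, U \in Us -> (r U < h)%N) ->
    (forall U V, U \in Us -> V \in Us -> U `<` V -> (r U < r V)%N) ->
  exists F, [/\ F `<=` fpowerset (ground n), sperner l F &
    forall U, U \in Us -> game S F b U].
Proof.
elim: b Us r h => [|b IH] Us r h bn.
  rewrite addn0 muln1 => hl Usn rh rmono; exists Us; split=> //.
    by apply/fsubsetP => U /Usn; rewrite fpowersetE.
  by apply: (@rank_sperner _ _ r) => // C /rh; lia.
rewrite expn_gapsS /= => + Usn rh rmono.
have bU U : U \in Us -> b.+1 \notin U.
  by move/Usn/fsubsetP => h'; apply/negP => /h'; rewrite in_interval; lia.
have UsD U : U \in Us -> U `\ b.+1 = U by move/bU/mem_fsetD1.
have UsDU U : U \in Us -> (b.+1 |` U) `\ b.+1 = U by move/bU/fsetU1K.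
have Usn0 U : U \in Us -> U `<=` Defs.interval b.+1 n.
  move=> /Usn/fsubsetP h'; apply/fsubsetP => x /h'; rewrite !in_interval; lia.
have Usn1 U : U \in Us -> b.+1 |` U `<=` Defs.interval b.+1 n.
  by move=> /Usn0 h'; rewrite fsubUset h' fsub1set in_interval; lia.
case: ifP => _ hl.
- pose Us' := Us `|` [fset b.+1 |` U | U in Us].
  have Us'D X : X \in Us' -> X `\ b.+1 \in Us.
    by case/fsetUP => [XUs|/imfsetP[/= U UUs ->]]; rewrite ?(UsD X) ?(UsDU U).
  (* The order on Us' is contained in the product order Us x {0, 1}, so the
     answer at b+1 adds to the rank. *)
  pose r' X := (r (X `\ b.+1) + (b.+1 \in X))%N.
  have [||U|U /Us'D/rh|X Y XUs YUs|F [Fn spF gF]] := IH Us' r' h.+1.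
  + exact: ltnW.
  + by move: hl; lia.
  + by case/fsetUP => [/Usn0|/imfsetP[/= V /Usn1 + ->]].
  + by rewrite /r'; case: (_ \in _); lia.
  + rewrite /r' => XY; have [XYD|[-> /negPf-> ->]] := fproper_fsetD1 b.+1 XY.
      have := rmono _ _ (Us'D X XUs) (Us'D Y YUs) XYD.
      have := fsubsetP (fproper_sub XY) b.+1.
      by case: (b.+1 \in X); case: (b.+1 \in Y) => // h1; [have := h1 isT | | |]; lia.
    by rewrite addn0 addn1.
  exists F; split=> // U UUs; rewrite !gF ?in_fsetU ?UUs //.
  by rewrite in_imfset ?orbT.
(* Low ranks receive b+1 and high ranks do not, against the direction of
   inclusion: a low position is never contained in a high one any more. *)
- pose c := uphalf h.
  pose f U := if (r U < c)%N then b.+1 |` U else U.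
  have fD U : U \in Us -> f U `\ b.+1 = U.
    by rewrite /f => UUs; case: ifP => _; rewrite ?(UsDU U) ?(UsD U).
  have bf U : U \in Us -> (b.+1 \in f U) = (r U < c)%N.
    by rewrite /f => /bU/negPf nb; case: ifP => _; rewrite ?fset1U1.
  pose r' X := let m := r (X `\ b.+1) in if (m < c)%N then m else (m - c)%N.
  have hc : (c <= h <= c + c)%N by rewrite /c; lia.
  have [||X|X|X Y|F [Fn spF gF]] := IH [fset f U | U in Us] r' c.
  + exact: ltnW.
  + by move: hl; rewrite /c; lia.
  + by case/imfsetP => /= U UUs ->; rewrite /f; case: ifP => _; auto.
  + case/imfsetP => /= U UUs ->; rewrite /r' fD //=; have := rh U UUs.
    by case: (ltnP (r U) c); lia.
  + case/imfsetP => /= U UUs -> /imfsetP[/= V VUs ->] UV.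
    have := fsubsetP (fproper_sub UV) b.+1.
    have := fproper_fsetD1 b.+1 UV.
    rewrite /r' !bf // !fD //= => -[/(rmono _ _ UUs VUs)|[-> /negP//]].
    case: (ltnP (r U) c) => ?; case: (ltnP (r V) c) => ? ? h1 //;
      try have := h1 isT; lia.
  exists F; split=> // U UUs.
  have := gF (f U) (in_imfset _ _ UUs); rewrite /f.
  by case: ifP => _ ->; rewrite ?orbT.
Qed.

Lemma sperner_game_exists S n l :
  (weight S n < l * 2 ^ gaps S n)%N ->
  exists F, [/\ F `<=` fpowerset (ground n), sperner l F & game S F n fset0].
Proof.
move=> lt.
have [||U|U|U V|F [Fn spF gF]] := @rank_game S n l n [fset fset0] (fun=> 0%N) 1%N.
- by [].
- by rewrite add1n.
- by move=> /fset1P->; apply: fsub0set.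
- by [].
- by move=> /fset1P-> /fset1P->; rewrite (negPf (fproper_irrefl _)).
by exists F; split=> //; apply/gF/fset11.
Qed.

(** * The weight as a sum over the set *)

Lemma weight_sum S b :
  (weight S b)%:R =
  2 ^+ gaps S b * \sum_(x <- iota 1 b | x \in S) 1 / 2 ^+ gaps S x :> rat.
Proof.
elim: b => [|b IH]; first by rewrite big_nil mulr0.
rewrite -[X in iota 1 X]addn1 iotaD big_cat big_cons big_nil add1n /=.
rewrite gapsS; case: ifP => _; last first.
  by rewrite !addr0 addn1 exprS -mulrA -IH -mul2n natrM.
rewrite addn0 -natr1 IH addr0 mulrDr; congr (_ + _).
by rewrite mul1r divff // expf_neq0.
Qed.

Lemma increasing_inj (k : nat) (a : 'I_k -> nat) :
  (forall j j' : 'I_k, (j < j')%N -> (a j < a j')%N) -> injective a.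
Proof.
move=> a_incr j j' eqa; apply/val_inj.
by case: (ltngtP j j') => // /a_incr; lia.
Qed.

(** The elements of A that are at most a i are a 0, ..., a i, which are i + 1 in
    number; the other positive integers up to a i are the gaps. *)
Lemma gaps_enum (k : nat) (a : 'I_k -> nat) (A : {fset nat}) (i : 'I_k) :
    (forall j, (0 < a j)%N) ->
    (forall j j' : 'I_k, (j < j')%N -> (a j < a j')%N) ->
    A = [fset a j | j in 'I_k] ->
  gaps A (a i) = (a i - i.+1)%N.
Proof.
move=> a_pos a_incr A_def.
have a_le j j' : (a j <= a j')%N = (j <= j')%N.
  case: (ltngtP j j') => [/a_incr/ltnW->//|/a_incr|/val_inj->]; rewrite ?leqnn //.
  by move=> lt; apply/negbTE; rewrite -ltnNge.
have AP x : reflect (exists j, x = a j) (x \in A).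
  rewrite A_def; apply: (iffP idP) => [/imfsetP[j _ ->]|[j ->]]; first by exists j.
  by apply/imfsetP; exists j.
suff cA : count [pred x | x \in A] (iota 1 (a i)) = i.+1.
  by rewrite -cA -[X in (X - _)%N](size_iota 1)
             -(count_predC [pred x | x \in A]) addKn.
rewrite -size_filter.
have /perm_size-> : perm_eq (filter [pred x | x \in A] (iota 1 (a i)))
    (map a (filter (fun j : 'I_k => (j <= i)%N) (enum 'I_k))).
  apply: uniq_perm.
  - exact/filter_uniq/iota_uniq.
  - by rewrite (map_inj_uniq (increasing_inj a_incr)) filter_uniq // enum_uniq.
  move=> x; rewrite mem_filter mem_iota /=; apply/andP/mapP.
    case=> /AP[j ->] le; exists j => //.
    by rewrite mem_filter mem_enum andbT -a_le; lia.
  case=> j; rewrite mem_filter -a_le => /andP[le _] ->; split.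
    by apply/AP; exists j.
  by have := a_pos j; lia.
rewrite size_map size_filter.
have := count_map val (fun x => (x <= i)%N) (enum 'I_k).
rewrite val_enum_ord /= => <-.
rewrite -[X in iota 0 X](subnKC (ltn_ord i)) iotaD count_cat.
have /eq_in_count-> : {in iota 0 i.+1, (fun x => x <= i)%N =1 xpredT}.
  by move=> x; rewrite mem_iota; lia.
have /eq_in_count-> : {in iota (0 + i.+1) (k - i.+1), (fun x => x <= i)%N =1 xpred0}.
  by move=> x; rewrite mem_iota; lia.
by rewrite count_predT count_pred0 size_iota addn0.
Qed.

Lemma sum_lt_weight (k l n : nat) (a : 'I_k -> nat) (A : {fset nat}) :
    (forall j, (0 < a j)%N) ->
    (forall j j' : 'I_k, (j < j')%N -> (a j < a j')%N) ->
    A = [fset a j | j in 'I_k] -> A `<=` ground n ->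
  (\sum_(i < k) 1 / 2 ^+ (a i - i.+1)%N < l%:R :> rat)
  = (weight A n < l * 2 ^ gaps A n)%N.
Proof.
move=> a_pos a_incr A_def /fsubsetP An.
rewrite -(ltr_nat rat) weight_sum mulrC natrM natrX ltr_pM2r ?exprn_gt0 //.
congr (_ < _); rewrite -[RHS]big_filter.
under [LHS]eq_bigr => i _ do rewrite -(gaps_enum _ a_pos a_incr A_def).
rewrite -(big_map a xpredT (fun x => 1 / 2 ^+ gaps A x)).
apply: perm_big; apply: uniq_perm.
- by rewrite (map_inj_uniq (increasing_inj a_incr)) index_enum_uniq.
- exact/filter_uniq/iota_uniq.
move=> x; rewrite mem_filter mem_iota; apply/mapP/andP.
  case=> j _ ->; have aA : a j \in A by rewrite A_def; apply/imfsetP; exists j.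
  by split=> //; have := An _ aA; rewrite in_interval; lia.
by case; rewrite A_def => /imfsetP[/= j _ ->] _; exists j; rewrite ?mem_index_enum.
Qed.

(** * The criterion *)

Theorem theorem3p3 (k l : nat) (a : 'I_k -> nat) (A : {fset nat})
    (a_pos : forall i : 'I_k, (0 < a i)%N)
    (a_incr : forall i j : 'I_k, (i < j)%N -> (a i < a j)%N)
    (A_def : A = [fset a i | i in 'I_k])
    (l_pos : (0 < l)%N) :
  (exists (n : nat) (S : {fset {fset nat}}),
     [/\ S `<=` fpowerset (ground n), sperner l S & osh n S A])
  <-> \sum_(i < k) 1 / 2 ^+ (a i - i.+1)%N < l%:R :> rat.
Proof.
split=> [[n [F [/fsubsetP Fn spF [An oF]]]]|lt].
  rewrite (sum_lt_weight _ a_pos a_incr A_def An).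
  have Fn' C : C \in F -> C `<=` ground n by move/Fn; rewrite fpowersetE.
  have An' t : t \in A -> (0 < t <= n)%N.
    by move/(fsubsetP An); rewrite in_interval.
  have [C CF] := order_shatters_game oF Fn' An'.
  by rewrite above_ground ?Fn' //; apply: sperner_game.
pose n := (\max_(i < k) a i)%N.
have An' t : t \in A -> (0 < t <= n)%N.
  by rewrite A_def => /imfsetP[/= i _ ->]; rewrite a_pos; apply: leq_bigmax.
have An : A `<=` ground n.
  by apply/fsubsetP => t /An'; rewrite in_interval.
move: lt; rewrite (sum_lt_weight _ a_pos a_incr A_def An).
case/sperner_game_exists=> F [Fn spF gF].
have [//|F' [sF' _ _ oF']] := game_order_shatters n gF An'.
by exists n, F; split=> //; split=> //; apply: order_shatters_sub oF'.
Qed.
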